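(* Consider input-output data $(U,Y)$ with data matrices $Y_-\in\mathbb{R}^{p\times N}$, $U_-\in\mathbb{R}^{m\times N}$, $Z_-\in\mathbb{R}^{n\times N}$, instrumental data $R_-\in\mathbb{R}^{M\times N}$ and noise-bound matrices $Q_{11},Q_{12},Q_{22}$ with $Q_{22}\prec 0$, and a performance output $z(t)=C_z\zeta(t)+D_zu(t)$, as in the context. Let $\gamma>0$. The data $(U,Y)$ are informative for common $\mathcal{H}_2$ control (by an output-feedback controller $C(q^{-1})u(t)=D(q^{-1})y(t)$) with performance $\gamma$ if there exist $L\in\mathbb{R}^{m\times n}$, a symmetric matrix $Z\in\mathbb{R}^{p\times p}$, $P\in\mathbb{R}^{n\times n}$ with $P\succ0$, $\alpha\ge0$ and $\beta>0$ such that, with $F:=C_zP+D_zL$, one has $\operatorname{trace}Z<\gamma^2$, $$\begin{bmatrix} P-\beta I & 0 & 0 & J_1P+J_2L & 0 \\ 0 & 0 & 0 & P & 0 \\ 0 & 0 & 0 & L & 0 \\ P^\top J_1^\top+L^\top J_2^\top & P & L^\top & P & F^\top \\ 0 & 0 & 0 & F & I \end{bmatrix}-\alpha\begin{bmatrix} I & H_zY_-R_-^\top \\ 0 & -Z_-R_-^\top \\ 0 & -U_-R_-^\top \\ 0 & 0 \\ 0 & 0 \end{bmatrix}Q_e\begin{bmatrix} I & H_zY_-R_-^\top \\ 0 & -Z_-R_-^\top \\ 0 & -U_-R_-^\top \\ 0 & 0 \\ 0 & 0 \end{bmatrix}^\top\succeq0,$$ $$\begin{bmatrix} P & F^\top \\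 F & I \end{bmatrix}\succ0\quad\text{and}\quad\begin{bmatrix} Z & H_z^\top \\ H_z & P \end{bmatrix}\succeq0 .$$
   Context: All matrices are real; $\succ,\succeq,\prec$ refer to symmetric matrices in the (semi)definite order. Zero and identity blocks have the dimensions dictated by conformity. (The matrix variable $Z$ is unrelated to the data matrix $Z_-$.) System and data. Fix integers $p,m,l,N,M\ge1$ and let $n:=(p+m)l$. The system class is $A(q^{-1})y(t)=B(q^{-1})u(t)+e(t)$, $y(t)\in\mathbb{R}^p$, $u(t)\in\mathbb{R}^m$, noise $e(t)\in\mathbb{R}^p$, $q^{-1}$ the delay operator, $A(\xi)=I+A_1\xi+\cdots+A_l\xi^l$, $B(\xi)=B_0+B_1\xi+\cdots+B_l\xi^l$. Put $\bar A:=[-A_1\ \cdots\ -A_l]\in\mathbb{R}^{p\times pl}$, $\bar B:=[B_1\ \cdots\ B_l]\in\mathbb{R}^{p\times ml}$, and $\zeta(t):=\operatorname{col}(y(t-1),\dots,y(t-l),u(t-1),\dots,u(t-l))\in\mathbb{R}^n$. Data matrices: $Z_-=[\zeta(0)\cdots\zeta(N-1)]$, $Y_-=[y(0)\cdots y(N-1)]$, $U_-=[u(0)\cdots u(N-1)]$; the noise matrix $E_-=[e(0)\cdots e(N-1)]$ is unknown. The data equation is $$Y_-=[\bar A\ \ \bar B]Z_-+B_0U_-+E_-.\quad\text{(D)}$$ Noise bound. A given signal $r(t)\in\mathbb{R}^M$ defines $R_-=[r(0)\cdots r(N-1)]$. With a given symmetric matrix $Q=\begin{bmatrix} Q_{11}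 & Q_{12} \\ Q_{12}^\top & Q_{22} \end{bmatrix}$, $Q_{11}\in\mathbb{R}^{p\times p}$, $Q_{22}\in\mathbb{R}^{M\times M}$, $Q_{22}\prec0$, the noise is known to satisfy $$\begin{bmatrix} I \\ R_-E_-^\top \end{bmatrix}^\top Q\begin{bmatrix} I \\ R_-E_-^\top \end{bmatrix}\succeq0.\quad\text{(N)}$$ State-space matrices. Partition the $n$ rows into blocks of sizes $p,\ p(l-1),\ m,\ m(l-1)$. Let $H_z=\operatorname{col}(I_p,0,0,0)\in\mathbb{R}^{n\times p}$, $J_2=\operatorname{col}(0,0,I_m,0)\in\mathbb{R}^{n\times m}$, and let $J_1\in\mathbb{R}^{n\times n}$, with column blocks of sizes $p(l-1),p,m(l-1),m$, be $$J_1=\begin{bmatrix} 0 & 0 & 0 & 0 \\ I_{p(l-1)} & 0 & 0 & 0 \\ 0 & 0 & 0 & 0 \\ 0 & 0 & I_{m(l-1)} & 0 \end{bmatrix}.$$ Let $Q_e:=\begin{bmatrix} H_zQ_{11}H_z^\top & H_zQ_{12} \\ Q_{12}^\top H_z^\top & Q_{22} \end{bmatrix}$. Compatible systems. $\Sigma^{RQ}_{(U,Y)}$ is the set of all pairs $(\Lambda_e,B_e)=\left(\begin{bmatrix} \bar A & \bar B \\ 0 & 0 \end{bmatrix},\begin{bmatrix} B_0 \\ 0 \end{bmatrix}\right)\in\mathbb{R}^{n\times n}\times\mathbb{R}^{n\times m}$ (with $\bar A\in\mathbb{R}^{p\times pl}$, $\bar B\in\mathbb{R}^{p\times ml}$,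 $B_0\in\mathbb{R}^{p\times m}$) for which there exists $E_-\in\mathbb{R}^{p\times N}$ such that (D) and (N) hold. Further $\bar\Sigma^{RQ}_{(U,Y)}:=\{(\Lambda_e+J_1,B_e+J_2)\mid(\Lambda_e,B_e)\in\Sigma^{RQ}_{(U,Y)}\}$; its elements are denoted $(A_z,B_z)$, and $\zeta(t+1)=A_z\zeta(t)+B_zu(t)+H_ze(t)$. Controller. The output-feedback controller is $C(q^{-1})u(t)=D(q^{-1})y(t)$ with $C(\xi)=I+C_1\xi+\cdots+C_l\xi^l$ and $D(\xi)=D_1\xi+\cdots+D_l\xi^l$; equivalently $u(t)=K\zeta(t)$ with $K=[D_1\cdots D_l\ \ -C_1\cdots-C_l]\in\mathbb{R}^{m\times n}$. Performance. $C_z$ and $D_z$ are given matrices with $n$ and $m$ columns, respectively, and the same number of rows; the performance output is $z(t)=C_z\zeta(t)+D_zu(t)$. Write $A_K:=A_z+B_zK$ and $C_K:=C_z+D_zK$. Informativity. The data $(U,Y)$ are informative for common $\mathcal{H}_2$ control by an output-feedback controller with performance $\gamma$ if there exist $K\in\mathbb{R}^{m\times n}$ and a matrix $X\succ0$ such that for every $(A_z,B_z)\in\bar\Sigma^{RQ}_{(U,Y)}$ $$\operatorname{trace}H_z^\top XH_z<\gamma^2\quad\text{and}\quad X\succ A_K^\top XA_K+C_K^\top C_K .$$ *)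

(* Defs.v *)
From mathcomp Require Import all_boot all_order all_algebra.
From mathcomp Require Import reals.

Set Implicit Arguments.
Unset Strict Implicit.
Unset Printing Implicit Defensive.

Import Order.TTheory GRing.Theory Num.Theory.
Local Open Scope ring_scope.

Definition posdefmx (R : realType) (n : nat) (A : 'M[R]_n) : Prop :=
  A^T = A /\ forall x : 'cV[R]_n, x != 0 -> 0 < (x^T *m A *m x) 0 0.

Definition possemidefmx (R : realType) (n : nat) (A : 'M[R]_n) : Prop :=
  A^T = A /\ forall x : 'cV[R]_n, 0 <= (x^T *m A *m x) 0 0.

(* In every definition below the system order (number of lags) is [l.+1], so
   that it is at least 1 and [l] is the order minus one. The state dimension is
   (p + m) * order, written so that [l.+1 * p] is convertible to [p + l * p]:
   the rows split definitionally into blocks p, p(order-1), m, m(order-1). *)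
Notation zdim p m l := (l.+1 * p + l.+1 * m)%N.

(* col (s (t-1), ..., s (t-(l+1))); [mxvec] lists the entries row by row. *)
Definition lags (R : realType) (k l : nat) (s : int -> 'cV[R]_k) (t : int) :
    'cV[R]_(l.+1 * k) :=
  (mxvec (\matrix_(i < l.+1, j < k) s (t - (i.+1)%:Z) j 0))^T.

Definition zeta (R : realType) (p m l : nat) (y : int -> 'cV[R]_p)
    (u : int -> 'cV[R]_m) (t : int) : 'cV[R]_(zdim p m l) :=
  col_mx (lags l y t) (lags l u t).

Definition data_mx (R : realType) (k N : nat) (s : int -> 'cV[R]_k) :
    'M[R]_(k, N) :=
  \matrix_(i < k, t < N) s (t : nat)%:Z i 0.

Definition Hz (R : realType) (p m l : nat) : 'M[R]_(zdim p m l, p) :=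
  col_mx (col_mx 1%:M 0 : 'M[R]_(p + l * p, p))
         (0 : 'M[R]_(l.+1 * m, p)).

Definition J2 (R : realType) (p m l : nat) : 'M[R]_(zdim p m l, m) :=
  col_mx (0 : 'M[R]_(l.+1 * p, m))
         (col_mx 1%:M 0 : 'M[R]_(m + l * m, m)).

(* Row blocks k, l*k; column blocks l*k, k (hence the cast to a square type). *)
Definition shift_mx (R : realType) (k l : nat) : 'M[R]_(l.+1 * k) :=
  castmx (erefl (k + l * k)%N, addnC (l * k) k)
    (block_mx 0 0 1%:M 0 : 'M[R]_(k + l * k, l * k + k)).

Definition J1 (R : realType) (p m l : nat) : 'M[R]_(zdim p m l) :=
  block_mx (shift_mx R p l) 0 0 (shift_mx R m l).

Definition noise_bound (R : realType) (p M N : nat) (Rm : 'M[R]_(M, N))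
    (Q11 : 'M[R]_p) (Q12 : 'M[R]_(p, M)) (Q22 : 'M[R]_M)
    (Em : 'M[R]_(p, N)) : Prop :=
  let W : 'M[R]_(p + M, p) := col_mx 1%:M (Rm *m Em^T) in
  possemidefmx (W^T *m block_mx Q11 Q12 Q12^T Q22 *m W).

Definition compatible (R : realType) (p m l M N : nat)
    (Ym : 'M[R]_(p, N)) (Um : 'M[R]_(m, N)) (Zm : 'M[R]_(zdim p m l, N))
    (Rm : 'M[R]_(M, N))
    (Q11 : 'M[R]_p) (Q12 : 'M[R]_(p, M)) (Q22 : 'M[R]_M)
    (Le : 'M[R]_(zdim p m l)) (Be : 'M[R]_(zdim p m l, m)) : Prop :=
  exists (Abar : 'M[R]_(p, l.+1 * p)) (Bbar : 'M[R]_(p, l.+1 * m))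
         (B0 : 'M[R]_(p, m)),
    [/\ Le = col_mx (col_mx (row_mx Abar Bbar) 0
                       : 'M[R]_(p + l * p, zdim p m l))
                    (0 : 'M[R]_(l.+1 * m, zdim p m l)),
        Be = col_mx (col_mx B0 0 : 'M[R]_(p + l * p, m))
                    (0 : 'M[R]_(l.+1 * m, m))
      & exists Em : 'M[R]_(p, N),
          Ym = row_mx Abar Bbar *m Zm + B0 *m Um + Em
          /\ noise_bound Rm Q11 Q12 Q22 Em].

Definition compatible_ss (R : realType) (p m l M N : nat)
    (Ym : 'M[R]_(p, N)) (Um : 'M[R]_(m, N)) (Zm : 'M[R]_(zdim p m l, N))
    (Rm : 'M[R]_(M, N))
    (Q11 : 'M[R]_p) (Q12 : 'M[R]_(p, M)) (Q22 : 'M[R]_M)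
    (Az : 'M[R]_(zdim p m l)) (Bz : 'M[R]_(zdim p m l, m)) : Prop :=
  exists (Le : 'M[R]_(zdim p m l)) (Be : 'M[R]_(zdim p m l, m)),
    [/\ compatible Ym Um Zm Rm Q11 Q12 Q22 Le Be,
        Az = Le + J1 R p m l & Bz = Be + J2 R p m l].

(* [K] encodes the controller C(q^-1)u = D(q^-1)y with C(0) = I, D(0) = 0,
   i.e. u(t) = K zeta(t), K = [D_1 .. D_(l+1)  -C_1 .. -C_(l+1)]. *)
Definition informative_common_H2 (R : realType) (p m l M N q : nat)
    (Ym : 'M[R]_(p, N)) (Um : 'M[R]_(m, N)) (Zm : 'M[R]_(zdim p m l, N))
    (Rm : 'M[R]_(M, N))
    (Q11 : 'M[R]_p) (Q12 : 'M[R]_(p, M)) (Q22 : 'M[R]_M)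
    (Cz : 'M[R]_(q, zdim p m l)) (Dz : 'M[R]_(q, m)) (gamma : R) : Prop :=
  exists (K : 'M[R]_(m, zdim p m l)) (X : 'M[R]_(zdim p m l)),
    posdefmx X /\
    forall (Az : 'M[R]_(zdim p m l)) (Bz : 'M[R]_(zdim p m l, m)),
      compatible_ss Ym Um Zm Rm Q11 Q12 Q22 Az Bz ->
      let AK := Az + Bz *m K in
      let CK := Cz + Dz *m K in
      \tr ((Hz R p m l)^T *m X *m Hz R p m l) < gamma ^+ 2
      /\ posdefmx (X - (AK^T *m X *m AK + CK^T *m CK)).

Definition Qe_mx (R : realType) (p m l M : nat)
    (Q11 : 'M[R]_p) (Q12 : 'M[R]_(p, M)) (Q22 : 'M[R]_M) :
    'M[R]_(zdim p m l + M) :=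
  let H := Hz R p m l in
  block_mx (H *m Q11 *m H^T) (H *m Q12) (Q12^T *m H^T) Q22.

Notation lmidim p m l q :=
  (zdim p m l + (zdim p m l + (m + (zdim p m l + q))))%N.

Definition lmi_model (R : realType) (p m l q : nat)
    (P : 'M[R]_(zdim p m l)) (L : 'M[R]_(m, zdim p m l))
    (F : 'M[R]_(q, zdim p m l)) (beta : R) : 'M[R]_(lmidim p m l q) :=
  let n := zdim p m l in
  let J1 := J1 R p m l in
  let J2 := J2 R p m l in
  let row5 k (X1 X2 : 'M[R]_(k, n)) (X3 : 'M[R]_(k, m)) (X4 : 'M[R]_(k, n))
      (X5 : 'M[R]_(k, q)) :=
    row_mx X1 (row_mx X2 (row_mx X3 (row_mx X4 X5))) in
  col_mx   (row5 n (P - beta%:M) 0 0 (J1 *m P + J2 *m L) 0)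
  (col_mx  (row5 n 0 0 0 P 0)
  (col_mx  (row5 m 0 0 0 L 0)
  (col_mx  (row5 n (P^T *m J1^T + L^T *m J2^T) P L^T P F^T)
           (row5 q 0 0 0 F 1%:M)))).

Definition lmi_data (R : realType) (p m l M N q : nat)
    (Ym : 'M[R]_(p, N)) (Um : 'M[R]_(m, N)) (Zm : 'M[R]_(zdim p m l, N))
    (Rm : 'M[R]_(M, N)) : 'M[R]_(lmidim p m l q, zdim p m l + M) :=
  let n := zdim p m l in
  col_mx   (row_mx (1%:M : 'M[R]_n) (Hz R p m l *m Ym *m Rm^T))
  (col_mx  (row_mx (0 : 'M[R]_n)    (- (Zm *m Rm^T)))
  (col_mx  (row_mx (0 : 'M[R]_(m, n)) (- (Um *m Rm^T)))
  (col_mx  (row_mx (0 : 'M[R]_n) 0)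
           (row_mx (0 : 'M[R]_(q, n)) 0)))).

(* Main.v *)
Require Import Defs.
From mathcomp Require Import all_boot all_order all_algebra.
From mathcomp Require Import reals ring.

Set Implicit Arguments.
Unset Strict Implicit.
Unset Printing Implicit Defensive.

Import Order.TTheory GRing.Theory Num.Theory.
Local Open Scope ring_scope.

(** With [K = L P^-1] and [X = P^-1], test the large LMI on the range of
    [col (S, Le^T S, Be^T S, I, -F)], where [S = - X A_K P].  For a compatible
    system the data term becomes [S^T H_z (.) H_z^T S] with (.) the noise
    quadratic matrix, hence is nonnegative, and what remains says that
    [P - F^T F - P A_K^T X A_K P - beta S^T S] is positive semidefinite.
    Strictness comes from the [beta]-term on vectors not killed by [S], and
    from the Schur complement [P - F^T F] on the kernel of [S]. *)

Lemma possemidefmx_congr (R : realType) (k n : nat) (A : 'M[R]_k)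
    (B : 'M[R]_(k, n)) :
  possemidefmx A -> possemidefmx (B^T *m A *m B).
Proof.
move=> [symA posA]; split; first by rewrite !trmx_mul trmxK symA mulmxA.
by move=> x; have := posA (B *m x); rewrite trmx_mul !mulmxA.
Qed.

Lemma posdefmx_congr (R : realType) (k n : nat) (A : 'M[R]_k)
    (B : 'M[R]_(k, n)) (C : 'M[R]_(n, k)) :
  C *m B = 1%:M -> posdefmx A -> posdefmx (B^T *m A *m B).
Proof.
move=> CB [symA posA]; split; first by rewrite !trmx_mul trmxK symA mulmxA.
move=> x x_neq0; have := posA (B *m x); rewrite trmx_mul !mulmxA; apply.
by apply: contraNneq x_neq0 => Bx0; rewrite -[x]mul1mx -CB -mulmxA Bx0 mulmx0.
Qed.

Lemma possemidefmxD (R : realType) (n : nat) (A B : 'M[R]_n) :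
  possemidefmx A -> possemidefmx B -> possemidefmx (A + B).
Proof.
move=> [symA posA] [symB posB]; split; first by rewrite linearD /= symA symB.
by move=> x; rewrite mulmxDr mulmxDl mxE addr_ge0.
Qed.

Lemma possemidefmxZ (R : realType) (n : nat) (a : R) (A : 'M[R]_n) :
  0 <= a -> possemidefmx A -> possemidefmx (a *: A).
Proof.
move=> a_ge0 [symA posA]; split; first by rewrite linearZ /= symA.
by move=> x; rewrite -scalemxAr -scalemxAl mxE mulr_ge0.
Qed.

Lemma posdefmx_unit (R : realType) (n : nat) (A : 'M[R]_n) :
  posdefmx A -> A \in unitmx.
Proof.
move=> [_ posA]; rewrite unitmxE unitfE; apply/det0P => -[v v_neq0 vA].
have := posA v^T; rewrite trmx_eq0 => /(_ v_neq0).
by rewrite trmxK vA mul0mx mxE ltxx.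
Qed.

Lemma posdefmx_inv (R : realType) (n : nat) (A : 'M[R]_n) :
  posdefmx A -> posdefmx (invmx A).
Proof.
move=> pdA; have uA := posdefmx_unit pdA.
have symV : (invmx A)^T = invmx A by rewrite trmx_inv (proj1 pdA).
have -> : invmx A = (invmx A)^T *m A *m invmx A by rewrite symV mulVmx ?mul1mx.
exact: posdefmx_congr (mulmxV uA) pdA.
Qed.

Lemma possemidefmx_trace_ge0 (R : realType) (n : nat) (A : 'M[R]_n) :
  possemidefmx A -> 0 <= \tr A.
Proof.
move=> [_ posA]; apply: sumr_ge0 => i _; have := posA (delta_mx i 0).
by rewrite trmx_delta -rowE -colE !mxE.
Qed.

Lemma sqnorm_gt0 (R : realType) (n : nat) (x : 'cV[R]_n) :
  x != 0 -> 0 < (x^T *m x) 0 0.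
Proof.
move=> x_neq0; have [i xi] : exists i, x i 0 != 0 by apply/cV0Pn.
rewrite mxE (bigD1 i) //= ltr_pwDl //.
  by rewrite mxE -expr2 exprn_even_gt0.
by apply: sumr_ge0 => j _; rewrite mxE -expr2 sqr_ge0.
Qed.

(** Congruence by [col_mx 1%:M (- F)] cancels the cross terms; [row_mx 1%:M 0] is a left inverse of
    it, so strictness survives. *)
Lemma posdefmx_schur1 (R : realType) (n q : nat) (P : 'M[R]_n)
    (F : 'M[R]_(q, n)) :
  posdefmx (block_mx P F^T F 1%:M) -> posdefmx (P - F^T *m F).
Proof.
move=> /(@posdefmx_congr _ _ _ _ (col_mx 1%:M (- F)) (row_mx 1%:M 0)).
rewrite mul_row_col mulmx1 mul0mx addr0 => /(_ erefl).
rewrite tr_col_mx mul_row_block mul_row_col trmx1 linearN /=.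
by rewrite !mul1mx !mulmx1 addrN mul0mx addr0 mulNmx.
Qed.

(** Congruence by [col_mx 1%:M (- (invmx P *m H))] eliminates the off-diagonal block. *)
Lemma possemidefmx_schur (R : realType) (k n : nat) (Z : 'M[R]_k)
    (H : 'M[R]_(n, k)) (P : 'M[R]_n) :
  P \in unitmx -> P^T = P -> possemidefmx (block_mx Z H^T H P) ->
  possemidefmx (Z - H^T *m invmx P *m H).
Proof.
move=> uP symP.
move=> /(@possemidefmx_congr _ _ _ _ (col_mx 1%:M (- (invmx P *m H)))).
rewrite tr_col_mx mul_row_block mul_row_col trmx1 linearN /= trmx_mul.
rewrite trmx_inv symP !mul1mx !mulmx1 [- _ *m P]mulNmx mulmxKV // addrN mul0mx.
by rewrite addr0 mulNmx.
Qed.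

(** Source of strictness. If [S *m w = 0], the forms of [D] and [Y] agree at [w]; otherwise the form
    of [D] is at least [beta] times the squared norm of [S *m w], which is positive. *)
Lemma posdefmx_sub_sqr (R : realType) (n k : nat) (D Y : 'M[R]_n)
    (S : 'M[R]_(k, n)) (V : 'M[R]_(n, k)) (beta : R) :
  0 < beta -> posdefmx Y -> D = Y + V *m S ->
  possemidefmx (D - beta *: (S^T *m S)) -> posdefmx D.
Proof.
move=> beta_gt0 [_ posY] defD [symD posD]; split.
  move: symD; rewrite linearB linearZ /= trmx_mul trmxK.
  exact: addIr.
move=> w w_neq0; have [Sw0|Sw_neq0] := eqVneq (S *m w) 0.
  rewrite defD mulmxDr mulmxDl -!mulmxA Sw0 !mulmx0 addr0 mulmxA.
  exact: posY.
have := posD w; rewrite mulmxBr mulmxBl mxE [X in _ + X]mxE subr_ge0.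
apply: lt_le_trans; rewrite -scalemxAr -scalemxAl mxE mulr_gt0 //.
by have := sqnorm_gt0 Sw_neq0; rewrite trmx_mul !mulmxA.
Qed.

(** Puts the zero-padded matrices of [compatible] into the factored form that [lmi_data_congr]
    expects. *)
Lemma compatible_Hz (R : realType) (p m l k : nat)
    (A : 'M[R]_(p, k)) :
  col_mx (col_mx A 0 : 'M[R]_(p + l * p, k)) (0 : 'M[R]_(l.+1 * m, k))
  = Hz R p m l *m A.
Proof.
rewrite /Hz mul_col_mx mul0mx.
by congr (col_mx _ _); rewrite mul_col_mx mul1mx mul0mx.
Qed.

Lemma mulmx_congrA (R : realType) (k n j : nat) (A : 'M[R]_n)
    (B : 'M[R]_(n, k)) (C : 'M[R]_(k, j)) :
  C^T *m (B^T *m A *m B) *m C = (B *m C)^T *m A *m (B *m C).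
Proof. by rewrite trmx_mul !mulmxA. Qed.

(* The noise realization turns [G^T T] into [col (I, R_- E_-^T) H_z^T S]. *)
Lemma lmi_data_congr (R : realType) (p m l M N q k : nat)
    (Ym : 'M[R]_(p, N)) (Um : 'M[R]_(m, N)) (Zm : 'M[R]_(zdim p m l, N))
    (Rm : 'M[R]_(M, N))
    (Q11 : 'M[R]_p) (Q12 : 'M[R]_(p, M)) (Q22 : 'M[R]_M)
    (AB : 'M[R]_(p, zdim p m l)) (B0 : 'M[R]_(p, m)) (Em : 'M[R]_(p, N))
    (S T4 : 'M[R]_(zdim p m l, k)) (T5 : 'M[R]_(q, k)) :
  let H := Hz R p m l in
  let G := lmi_data q Ym Um Zm Rm in
  let T := col_mx S (col_mx ((H *m AB)^T *m S)
             (col_mx ((H *m B0)^T *m S) (col_mx T4 T5))) in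
  let W : 'M[R]_(p + M, p) := col_mx 1%:M (Rm *m Em^T) in
  Ym = AB *m Zm + B0 *m Um + Em ->
  T^T *m (G *m Qe_mx m l Q11 Q12 Q22 *m G^T) *m T
  = (H^T *m S)^T *m (W^T *m block_mx Q11 Q12 Q12^T Q22 *m W) *m (H^T *m S).
Proof.
move=> H G T W defY; rewrite -{1}[G]trmxK !mulmx_congrA.
have -> : G^T *m T = col_mx S (Rm *m Em^T *m (H^T *m S)).
  rewrite /G /T /lmi_data -/H; move: H {G T W} => H.
  rewrite !tr_col_mx !tr_row_mx !mul_row_col.
  rewrite !trmx0 trmx1 !mul_col_mx !add_col_mx !mul0mx !addr0 mul1mx.
  (* In the second block [H^T] factors out and the data equation leaves only the noise:
     [Ym - AB *m Zm - B0 *m Um] is [Em]. *)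
  congr col_mx; rewrite defY !raddfN /= !trmx_mul !mulNmx !raddfD /=.
  rewrite !(mulmxDl, mulmxDr) !trmx_mul !trmxK !mulmxA.
  by rewrite -opprD addrAC addrN add0r.
rewrite /W /Qe_mx -/H; move: H {G T W} => H.
rewrite mul_col_mx mul1mx !tr_col_mx !mul_row_block !mul_row_col.
by rewrite !trmx_mul !trmxK !mulmxDl !mulmxA.
Qed.

(** Blocks 2 and 3 of [T] add [Le] and [Be] to the known shifts [J1] and [J2], which produces the
    closed-loop term [V]. The last block [- F] makes the fifth block of the product vanish and
    leaves [- F^T *m F]. *)
Lemma lmi_model_congr (R : realType) (p m l q : nat)
    (P : 'M[R]_(zdim p m l)) (L : 'M[R]_(m, zdim p m l))
    (F : 'M[R]_(q, zdim p m l)) (beta : R) (S Le : 'M[R]_(zdim p m l))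
    (Be : 'M[R]_(zdim p m l, m)) :
  let T := col_mx S (col_mx (Le^T *m S)
             (col_mx (Be^T *m S) (col_mx 1%:M (- F)))) in
  let V := (Le + J1 R p m l) *m P + (Be + J2 R p m l) *m L in
  P^T = P ->
  T^T *m lmi_model P L F beta *m T
  = S^T *m P *m S + S^T *m V + V^T *m S + P - F^T *m F - beta *: (S^T *m S).
Proof.
rewrite /lmi_model; move: (J1 R p m l) (J2 R p m l) => j1 j2 /= symP.
rewrite -mulmxA !mul_col_mx !mul_row_col !tr_col_mx !mul_row_col.
rewrite !mul0mx !addr0 !add0r !mulmx1 trmx1 mul1mx.
rewrite !mul1mx !mulmxN addrN mulmx0 addr0.
rewrite !raddfD /= !trmx_mul !trmxK symP.
rewrite !(mulmxBl, mulmxDl, mulmxDr, mulNmx) -?scalemxAr mul_scalar_mx.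
rewrite !mulmxA mulmxN -scalemxAr !raddfD /= !(mulmxDr, mulmxDl).
(* Abstracting the products stops [mxE] from expanding them into sums, so [ring] sees only scalar
   atoms. *)
move: (S^T *m P *m S) (S^T *m S) (F^T *m F) => X1 X2 X3.
move: (S^T *m j1 *m P) (S^T *m j2 *m L) (P *m j1^T *m S) => X4 X5 X6.
move: (L^T *m j2^T *m S) (S^T *m Le *m P) (S^T *m Be *m L) => X7 X8 X9.
move: (P *m Le^T *m S) (L^T *m Be^T *m S) => X10 X11.
by apply/matrixP => i j; rewrite !mxE; ring.
Qed.

Theorem theorem3 (R : realType) (p m l M N q : nat)
    (hp : (0 < p)%N) (hm : (0 < m)%N) (hM : (0 < M)%N) (hN : (0 < N)%N)
    (y : int -> 'cV[R]_p) (u : int -> 'cV[R]_m) (r : int -> 'cV[R]_M)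
    (Q11 : 'M[R]_p) (Q12 : 'M[R]_(p, M)) (Q22 : 'M[R]_M)
    (hQ11 : Q11^T = Q11) (hQ22 : posdefmx (- Q22))
    (Cz : 'M[R]_(q, zdim p m l)) (Dz : 'M[R]_(q, m))
    (gamma : R) (hgamma : 0 < gamma) :
  let Ym : 'M[R]_(p, N) := data_mx N y in
  let Um : 'M[R]_(m, N) := data_mx N u in
  let Zm : 'M[R]_(zdim p m l, N) := data_mx N (zeta l y u) in
  let Rm : 'M[R]_(M, N) := data_mx N r in
  (exists (L : 'M[R]_(m, zdim p m l)) (Z : 'M[R]_p) (P : 'M[R]_(zdim p m l))
          (alpha beta : R),
     let F := Cz *m P + Dz *m L in
     let G := lmi_data q Ym Um Zm Rm in
     Z^T = Z /\ posdefmx P /\ 0 <= alpha /\ 0 < beta /\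
     \tr Z < gamma ^+ 2 /\
     possemidefmx (lmi_model P L F beta
                   - alpha *: (G *m Qe_mx m l Q11 Q12 Q22 *m G^T)) /\
     posdefmx (block_mx P F^T F 1%:M) /\
     possemidefmx (block_mx Z (Hz R p m l)^T (Hz R p m l) P)) ->
  informative_common_H2 Ym Um Zm Rm Q11 Q12 Q22 Cz Dz gamma.
Proof.
move=> Ym Um Zm Rm [L [Z [P [alpha [beta [_ [pdP [alpha_ge0]]]]]]]].
set F : 'M_(q, zdim p m l) := Cz *m P + Dz *m L; set G := lmi_data _ _ _ _ _.
move=> [beta_gt0 [trZ [lmi [/posdefmx_schur1 pdF psdZ]]]].
have uP := posdefmx_unit pdP; have symP := proj1 pdP.
set X : 'M_(zdim p m l) := invmx P; have symX : X^T = X by rewrite trmx_inv symP.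
exists (L *m X), X; split; first exact: posdefmx_inv.
move=> Az Bz [Le [Be [[Abar [Bbar [B0 [defLe defBe]]]]]]].
move=> [Em [defY noiseE]] defAz defBz AK CK; split.
  (* The Schur complement of the last LMI gives that [Z] dominates [Hz^T X Hz], hence so does its
     trace. *)
  apply: le_lt_trans trZ; rewrite -subr_ge0 -raddfB /=.
  exact: possemidefmx_trace_ge0 (possemidefmx_schur uP symP psdZ).
set V : 'M_(zdim p m l) := Az *m P + Bz *m L.
(* Since [V] is [AK *m P], this is the minimizer of [S^T P S + S^T V + V^T S], with minimum
   [V^T S = - V^T X V]. *)
pose S : 'M_(zdim p m l) := - (X *m V).
pose T := col_mx S (col_mx (Le^T *m S)
            (col_mx (Be^T *m S) (col_mx 1%:M (- F)))).
have pdD : posdefmx (P - F^T *m F + V^T *m S).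
  apply: (posdefmx_sub_sqr beta_gt0 pdF erefl).
  have := possemidefmx_congr T lmi.
  rewrite mulmxBr mulmxBl -scalemxAr -scalemxAl.
  (* On the range of [T] the data term is a congruence of the noise form; adding [alpha] times it
     back leaves the model term alone. *)
  have := possemidefmxZ alpha_ge0
    (possemidefmx_congr ((Hz R p m l)^T *m S) noiseE).
  rewrite -(lmi_data_congr _ _ _ _ _ 1%:M (- F) defY) -!compatible_Hz -defLe -defBe.
  move=> psd1 /possemidefmxD /(_ psd1); rewrite subrK lmi_model_congr //.
  rewrite -defAz -defBz -/V.
  (* As [P *m S = - V], two of the three terms in [S] cancel. *)
  suff -> : S^T *m P *m S = - (S^T *m V).
    by rewrite addNr add0r -[V^T *m S + P - _]addrA [V^T *m S + _]addrC.
  by rewrite -mulmxA {2}/S mulmxN mulKVmx // mulmxN.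
(* Congruence by [X = P^-1] turns [V] into [AK] and [F] into [CK]. *)
have -> : X - (AK^T *m X *m AK + CK^T *m CK)
    = X^T *m (P - F^T *m F + V^T *m S) *m X.
  have VX : V *m X = AK by rewrite mulmxDl mulmxK // -mulmxA.
  have FX : F *m X = CK by rewrite mulmxDl mulmxK // -mulmxA.
  rewrite -VX -FX !trmx_mul symX /S mulmxN !(mulmxDr, mulmxDl, mulmxN, mulNmx).
  by rewrite mulVmx // mul1mx !mulmxA opprD addrA addrAC.
exact: posdefmx_congr (mulmxV uP) pdD.
Qed.
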